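(* There exists a universal constant $C<\infty$ such that the following holds. Suppose $y_0:\mathbb{R}\to[0,\infty)$ is a locally Lipschitz function with $A_0:=\|y_0\|_{L^1(\mathbb{R})}\in(0,\infty)$, and let $y:\mathbb{R}\times[0,\infty)\to\mathbb{R}$ be the unique Ecker-Huisken solution of $y_t=\frac{y_{xx}}{1+y_x^2}$ starting with $y_0$. Then for all $t\geq\frac{2A_0}{\pi}$ we have $$y(x,t)\leq C t^{1/2}$$ for all $x\in\mathbb{R}$.
   Context: Graphical curve shortening flow is the equation $y_t=\frac{y_{xx}}{1+y_x^2}=(\arctan y_x)_x$. For every locally Lipschitz $y_0:\mathbb{R}\to\mathbb{R}$ there is (Ecker-Huisken existence, Chou-Zhu uniqueness) a unique continuous function $y:\mathbb{R}\times[0,\infty)\to\mathbb{R}$ that is smooth and solves this equation on $\mathbb{R}\times(0,\infty)$, with $y(\cdot,0)=y_0$ and $y(\cdot,t)\to y_0$ locally uniformly as $t\downarrow 0$. It is called the Ecker-Huisken solution starting with $y_0$. *)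

(* Defs.v *)
From HB Require Import structures.
From mathcomp Require Import all_boot all_order all_algebra.
From mathcomp Require Import all_classical all_reals all_analysis.

Set Implicit Arguments.
Unset Strict Implicit.
Unset Printing Implicit Defensive.

Import Order.TTheory GRing.Theory Num.Theory.
Import numFieldNormedType.Exports.

Local Open Scope classical_set_scope.
Local Open Scope ring_scope.

Definition locally_lipschitz (R : realType) (f : R -> R) : Prop :=
  forall x : R, exists2 U : set R, nbhs x U & [lipschitz f z | z in U].

(* Points of R * R are pairs (x, t): space first, time second. *)
Definition partial_x (R : realType) (f : R * R -> R) : R * R -> R :=
  'D_((1, 0) : R * R) f.

Definition partial_t (R : realType) (f : R * R -> R) : R * R -> R :=
  'D_((0, 1) : R * R) f.

(* All partial derivatives of order at most n, mixed ones included and in any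
   order of differentiation, exist and are jointly continuous at every point of
   U.  U is meant to be open, so that only the values of f on U matter. *)
Fixpoint Cn_on (R : realType) (n : nat) (U : set (R * R)) (f : R * R -> R)
    : Prop :=
  (forall p, U p -> {for p, continuous f}) /\
  (if n is m.+1 then
     [/\ forall p, U p -> derivable f p ((1, 0) : R * R),
         forall p, U p -> derivable f p ((0, 1) : R * R),
         Cn_on m U (partial_x f) & Cn_on m U (partial_t f)]
   else True).

Definition smooth_on (R : realType) (U : set (R * R)) (f : R * R -> R) : Prop :=
  forall n, Cn_on n U f.

(* A function on R x [0, oo) is represented by a total function on R * R; its
   values at negative times are unconstrained and play no role. *)
Record Ecker_Huisken_solution (R : realType) (y0 : R -> R) (y : R * R -> R)
    : Prop := {
  EH_continuous : {within [set p : R * R | 0 <= p.2], continuous y};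
  EH_smooth : smooth_on [set p : R * R | 0 < p.2] y;
  EH_equation : forall p : R * R, 0 < p.2 ->
    partial_t y p = partial_x (partial_x y) p / (1 + partial_x y p ^+ 2);
  EH_initial : forall x : R, y (x, 0) = y0 x;
  EH_locally_uniform :
    {family compact, (fun t x : R => y (x, t)) @ 0^'+ --> y0}
}.

(* Main.v *)
Require Import Defs.
From HB Require Import structures.
From mathcomp Require Import all_boot all_order all_algebra.
From mathcomp Require Import all_classical all_reals all_analysis.
From mathcomp Require Import measurable_realfun ring lra.
Set Implicit Arguments.
Unset Strict Implicit.
Unset Printing Implicit Defensive.

Import Order.TTheory GRing.Theory Num.Theory.
Import numFieldNormedType.Exports.
Local Open Scope classical_set_scope.
Local Open Scope ring_scope.

(** The proof is a maximum principle for the mass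
    [M(x, x', t)], the integral of [y(., t)] over [[x, x']].  Writing
    [theta = arctan y_x], the equation says
    [M_t = theta(x') - theta(x)], with [M_x'x' = y_x(x')] and
    [M_xx = - y_x(x)].  If [M - phi(x' - x, t)] is maximal at an interior point,
    both second derivatives give [y_x(x') <= phi_ss] and [- y_x(x) <= phi_ss], so
    [M_t <= 2 arctan phi_ss]; hence every [phi] with
    [phi_t >= 2 arctan phi_ss] is a barrier.  The constant [A = pi t / 2 >= A0] is
    one, so masses stay below [A].  For [l = sqrt t] and [0 <= s <= 2 l], the
    parabola [phi(s, r) = 2 l s - s^2 / 2 + A - (pi / 2) r] is another one,
    because [2 arctan (-1) = - pi / 2]; at time [r = t] it gives [M <= 2 l s], and
    [s -> 0] yields [y <= 2 l].

    Nothing is known on [y] at infinity.  Since [M_t < pi] whatever [y] is, adding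
    [eps (1 + t) (x^2 + x'^2 + const)] to the barrier rules out a maximum at
    large [x] or [x'], where the time derivative of this term exceeds [2 pi].
    There one may therefore add an arbitrarily steep penalty in space, which keeps
    the maximum away from the lateral boundary. *)

(** * One-variable calculus: derivatives at maxima, and [atan] *)

(** Were [C < l], every quotient with a small increment would exceed [C]. Arbitrarily small [h] of
    either sign suffice, so one-sided increments and mean value points are both admissible. *)
Lemma is_derive_le (R : realType) (f : R -> R) (x l C : R) :
  is_derive x 1 f l ->
  (forall e : R, 0 < e -> exists h : R, [/\ h != 0, `|h| < e & (f (x + h) - f x) / h <= C]) ->
  l <= C.
Proof.
move=> fl small; rewrite leNgt; apply/negP => Cl.
have [/cvg_ex[m fm] fE] := fl.
have ml : m = l by rewrite -fE; apply/esym/cvg_lim.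
rewrite {}ml in fm.
have [e /= e0 he] := cvgr_gt _ fm _ Cl.
have [h [h0 hle hC]] := small _ e0.
have := he h; rewrite /= sub0r normrN => /(_ hle h0).
rewrite /= /GRing.scale /= mulr1 (addrC h) mulrC => /lt_le_trans/(_ hC).
by rewrite ltxx.
Qed.

(** One-sided because a maximum in time may sit at the final time. *)
Lemma is_derive_ge0_left (R : realType) (f : R -> R) (x l d : R) :
  is_derive x 1 f l -> 0 < d ->
  (forall h, 0 < h -> h < d -> f (x - h) <= f x) -> 0 <= l.
Proof.
move=> fl d0 fd; rewrite -oppr_le0.
apply: (is_derive_le (f := - f) (x := x)) => // e e0.
have m0 : 0 < Num.min e d / 2 by rewrite divr_gt0// lt_min e0.
exists (- (Num.min e d / 2)); split.
- by rewrite oppr_eq0 gt_eqF.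
- rewrite normrN gtr0_norm//; have := lexx (Num.min e d); rewrite le_min => /andP[]; lra.
- rewrite invrN mulrN -mulNr; apply: mulr_le0_ge0; last by rewrite invr_ge0 ltW.
  rewrite oppr_le0 /= !fctE; suff : f (x - Num.min e d / 2) <= f x by lra.
  apply: fd => //; have := lexx (Num.min e d); rewrite le_min => /andP[]; lra.
Qed.

(** Fermat gives [g c = 0]. The mean value theorem on [[c, c + r]] gives a point [z > c] as close to
    [c] as desired with [g z <= 0], so [(g z - g c) / (z - c) <= 0]. Continuity of the second
    derivative does not enter. *)
Lemma second_derivative_le0_at_max (R : realType) (f g : R -> R) (a b c l : R) :
  (forall x, x \in `]a, b[ -> is_derive x 1 f (g x)) -> c \in `]a, b[ ->
  (forall x, x \in `]a, b[ -> f x <= f c) -> is_derive c 1 g l -> l <= 0.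
Proof.
move=> fg cab fc gl.
have /andP[ac cb] : a < c < b by move: cab; rewrite in_itv.
have dfc : is_derive c 1 f 0.
  apply: (@derive1_at_max _ f a b) => //; first exact/ltW/(lt_trans ac).
  by move=> t /fg[].
have gc : g c = 0 by case: (fg _ cab) => _ <-; case: dfc.
apply: (is_derive_le gl) => e e0.
pose r := Num.min e (b - c) / 2.
have [re rb] : r < e /\ c + r < b.
  by have := lexx (Num.min e (b - c)); rewrite le_min /r => /andP[]; lra.
have r0 : 0 < r by rewrite divr_gt0// lt_min e0 subr_gt0.
have sub x : x \in `[c, c + r] -> x \in `]a, b[.
  by rewrite !in_itv/= => /andP[? ?]; apply/andP; split; lra.
have crc : c < c + r by rewrite ltrDl.
have dfr x : x \in `]c, c + r[ -> is_derive x 1 f (g x).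
  by move=> /subset_itv_oo_cc/sub/fg.
have cfr : {within `[c, c + r], continuous f}.
  by apply: derivable_within_continuous => x /sub/fg[].
have [z] := MVT crc dfr cfr.
rewrite in_itv/= => /andP[cz zr] fE.
exists (z - c); split.
- by rewrite subr_eq0 gt_eqF.
- by rewrite gtr0_norm; lra.
- rewrite (addrC c) subrK gc subr0; apply: mulr_le0_ge0; last by rewrite invr_ge0; lra.
  have : g z * (c + r - c) <= 0.
    by rewrite -fE subr_le0; apply/fc/sub; rewrite in_itv/=; lra.
  by rewrite (addrC c r) addrK pmulr_lle0.
Qed.

Lemma atan_addr_le (R : realType) (x h : R) : 0 <= h -> atan (x + h) <= atan x + h.
Proof.
rewrite le_eqVlt => /predU1P[<-|h0]; first by rewrite !addr0.
have xh : x < x + h by rewrite ltrDl.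
have [c _] := @MVT R atan (fun z => (1 + z ^+ 2)^-1) _ _ xh
  (fun z _ => is_derive1_atan z)
  (continuous_subspaceT (@continuous_atan R)).
rewrite (addrC x h) addrK => E; rewrite -lerBlDl E.
rewrite ler_piMl ?(ltW h0)// invf_le1 ?lerDl ?sqr_ge0//.
by rewrite ltr_pwDl ?sqr_ge0.
Qed.

(** * The two-point maximum principle *)

(* [u] is a space primitive of [v]; [k] is the flux through the base point of the
   integral, which cancels in differences [u (x', t) - u (x, t)]. *)
Record flux_potential (R : realType) (a : R) (u v q : R * R -> R) (k : R -> R)
    : Prop := {
  fp_continuous : forall p : R * R, a < p.1 -> {for p, continuous u};
  fp_space : forall x t : R, a < x -> is_derive x 1 (fun z : R => u (z, t)) (v (x, t));
  fp_slope : forall x t : R, 0 < t -> is_derive x 1 (fun z : R => v (z, t)) (q (x, t));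
  fp_time : forall x t : R, a < x -> 0 < t ->
    is_derive t 1 (fun s : R => u (x, s)) (atan (q (x, t)) - k t)
}.

(** In each single variable, the penalized gap below is a combination of values of [u] plus a
    quadratic polynomial, so this rule and the next one yield all its derivatives. *)
Lemma is_derive_add_quadratic (R : realType) (s A B C x l : R) (f : R -> R) :
  is_derive x 1 f l ->
  is_derive x 1 (fun z : R => s * f z + (A * z ^+ 2 + B * z + C))
    (s * l + (2 * A * x + B)).
Proof.
move=> fl.
have -> : (fun z : R => s * f z + (A * z ^+ 2 + B * z + C)) =
    (s \*: f) + (A \*: (id ^+ 2) + B \*: id + cst C) by apply/funext => z.
have -> : s * l + (2 * A * x + B) =
    s *: l + (A *: ((2%:R * x ^+ 1) *: 1) + B *: 1 + 0).
  by rewrite /GRing.scale /= expr1; ring.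
have dq := is_deriveD (is_deriveZ A (is_deriveX 2 (is_derive_id x 1)))
  (is_deriveZ B (is_derive_id x 1)).
exact: is_deriveD (is_deriveZ s fl) (is_deriveD dq (is_derive_cst C x 1)).
Qed.
Lemma is_derive_sum_quadratic (R : realType) (r s A B C x l m : R) (f g : R -> R) :
  is_derive x 1 f l -> is_derive x 1 g m ->
  is_derive x 1 (fun z : R => r * f z + s * g z + (A * z ^+ 2 + B * z + C))
    (r * l + s * m + (2 * A * x + B)).
Proof.
move=> fl gm.
have -> : (fun z : R => r * f z + s * g z + (A * z ^+ 2 + B * z + C)) =
    (r \*: f) + (fun z => s * g z + (A * z ^+ 2 + B * z + C)).
  by apply/funext => z; rewrite /= -addrA.
rewrite -addrA; exact: is_deriveD (is_deriveZ _ fl) (is_derive_add_quadratic _ _ _ _ gm).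
Qed.

(** The barriers [phi(s, t)]: since [phi_ss = - K] and [phi_t = - c], the condition
    [phi_t >= 2 atan phi_ss] reads [c <= 2 * atan K]. *)
Definition parabola (R : realType) (p K c d s t : R) :=
  p * s - K * s ^+ 2 / 2 - c * t + d.

(** The coordinates are [x], the gap [s = x' - x] and time: with them the constraint
    [x <= x' <= x + S] becomes a side of a compact box. *)
Lemma exists_max_box (R : realType) (L S T : R) (f : R * R * R -> R) :
  0 <= L -> 0 <= S -> 0 <= T ->
  (forall x s t : R, -L <= x <= L -> 0 <= s <= S -> 0 <= t <= T ->
    {for (x, s, t), continuous f}) ->
  exists x s t : R, [/\ -L <= x <= L, 0 <= s <= S, 0 <= t <= T &
    forall x' s' t' : R, -L <= x' <= L -> 0 <= s' <= S -> 0 <= t' <= T ->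
      f (x', s', t') <= f (x, s, t)].
Proof.
move=> L0 S0 T0 cf.
pose D : set (R * R * R) := (`[-L, L] `*` `[0, S]) `*` `[0, T].
have [|||[[x s] t]] := @compact_EVT_max _ R f D.
- by exists (0, 0, 0); rewrite /D /= !in_itv/= !lexx/= oppr_le0 L0 S0 T0.
- by apply: compact_setX; [apply: compact_setX|]; exact: segment_compact.
- apply: continuous_in_subspaceT => -[[x s] t]; rewrite inE /D /= !in_itv/=.
  by move=> [[hx hs] ht]; exact: cf.
rewrite inE /D /= !in_itv/= => -[[hx hs] ht] fmax.
exists x, s, t; split => // x' s' t' hx' hs' ht'.
by apply: fmax; rewrite inE /= !in_itv.
Qed.

Lemma atan_le_slope (R : realType) (r K e : R) : r <= - K + e -> 0 <= e ->
  atan r <= - atan K + e.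
Proof.
move=> rK e0; rewrite -atanN; apply: le_trans (atan_addr_le _ e0).
exact: le_atan.
Qed.

(** The factor [1 + t] makes the penalty grow in time. Its quadratic part costs [2 * eps * (1 + t)]
    in each of the two second-derivative conditions, at most [4 * eps * (1 + T)] together; the
    constant [2 * (3 + 2 * T)] strictly outweighs this. *)
Definition penalized_gap (R : realType) (u : R * R -> R) (p K c d eps T x x' t : R) :=
  u (x', t) - u (x, t) - parabola p K c d (x' - x) t
  - eps * (1 + t) * (x ^+ 2 + x' ^+ 2 + 2 * (3 + 2 * T)).

(* The steep lateral penalty does not appear: it vanishes on [(- N, N)] and does
   not depend on time, so outside only maximality in time is available. *)
Lemma penalized_gap_max (R : realType) (u v q : R * R -> R) (k : R -> R)
    (a p K c d eps T N S x x' t : R) :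
  flux_potential a u v q k ->
  0 < eps -> 2 * pi <= eps * N ^+ 2 -> 0 <= N -> c <= 2 * atan K -> t <= T ->
  a < x -> x < x' -> x' < x + S -> 0 < t ->
  (forall h : R, 0 < h -> h < t ->
    penalized_gap u p K c d eps T x x' (t - h) <=
    penalized_gap u p K c d eps T x x' t) ->
  (- N < x -> x' < N -> forall z : R, x <= z -> z <= x + S -> - N < z -> z < N ->
    penalized_gap u p K c d eps T x z t <=
    penalized_gap u p K c d eps T x x' t) ->
  (- N < x -> x' < N -> forall z : R, a < z -> z <= x' -> x' <= z + S -> - N < z -> z < N ->
    penalized_gap u p K c d eps T z x' t <=
    penalized_gap u p K c d eps T x x' t) ->
  False.
Proof.
move=> fp e0 epsN N0 cK tT ax xx' x'S t0 maxt maxx' maxx.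
have ax' : a < x' by exact: lt_trans xx'.
(* Maximality among earlier times bounds the time derivative below; the flux [k t] cancels between
   [x'] and [x]. *)
have dt : 0 <= atan (q (x', t)) - atan (q (x, t)) + c
               - eps * (x ^+ 2 + x' ^+ 2 + 2 * (3 + 2 * T)).
  apply: (is_derive_ge0_left (f := penalized_gap u p K c d eps T x x') _ t0 maxt).
  have -> : penalized_gap u p K c d eps T x x' = (fun s : R =>
      1 * u (x', s) + (-1) * u (x, s) + (0 * s ^+ 2 +
        (c - eps * (x ^+ 2 + x' ^+ 2 + 2 * (3 + 2 * T))) * s +
        (- (p * (x' - x) - K * (x' - x) ^+ 2 / 2 + d) -
           eps * (x ^+ 2 + x' ^+ 2 + 2 * (3 + 2 * T))))).
    by apply/funext => s; rewrite /penalized_gap /parabola; field.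
  have := is_derive_sum_quadratic 1 (-1) 0
    (c - eps * (x ^+ 2 + x' ^+ 2 + 2 * (3 + 2 * T)))
    (- (p * (x' - x) - K * (x' - x) ^+ 2 / 2 + d) -
           eps * (x ^+ 2 + x' ^+ 2 + 2 * (3 + 2 * T)))
    (fp_time fp ax' t0) (fp_time fp ax t0).
  by move=> dE; apply: is_derive_eq dE _; ring.
have pi0 : 0 < pi :> R := pi_gt0 R.
have := atan_ltpi2 (q (x', t)); have := atan_gtNpi2 (q (x, t)); have := atan_ltpi2 K.
have := sqr_ge0 x; have := sqr_ge0 x' => x'2 x2 Kpi qx qx'.
have T0 : 0 < T by exact: lt_le_trans tT.
have eT : 0 < eps * T by exact: mulr_gt0.
have ex2 : 0 <= eps * x ^+ 2 by exact: mulr_ge0 (ltW e0) x2.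
have ex'2 : 0 <= eps * x' ^+ 2 by exact: mulr_ge0 (ltW e0) x'2.
(* Far out, no spatial information is needed: the two [atan] differ by less than [pi], [c < pi], and
   the penalty already takes away [2 * pi]. *)
have [Nx|xN] := leP x (- N).
  have : eps * N ^+ 2 <= eps * x ^+ 2 by rewrite ler_pM2l//; nra.
  by lra.
have [Nx'|x'N] := leP N x'.
  have : eps * N ^+ 2 <= eps * x' ^+ 2 by rewrite ler_pM2l//; nra.
  by lra.
have et : 0 <= 2 * eps * (1 + t) by nra.
(* Now both points lie in [(- N, N)], and the second-derivative test applies in [x'], then in
   [x]. *)
have qx'K : q (x', t) <= - K + 2 * eps * (1 + t).
  suff : 1 * q (x', t) + (2 * 0 * x' + (K - 2 * eps * (1 + t))) <= 0 by lra.
  apply: (@second_derivative_le0_at_max R (fun z : R => penalized_gap u p K c d eps T x z t)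
    (fun z : R => 1 * v (z, t) + (0 * z ^+ 2 + (K - 2 * eps * (1 + t)) * z + (- p - K * x)))
    x (Num.min N (x + S)) x').
  - move=> z; rewrite in_itv/= lt_min => /and3P[xz zN zS].
    have -> : (fun z : R => penalized_gap u p K c d eps T x z t) = (fun z : R =>
      1 * u (z, t) + ((K / 2 - eps * (1 + t)) * z ^+ 2 + (- p - K * x) * z +
       (- u (x, t) + p * x + K * x ^+ 2 / 2 + c * t - d -
         eps * (1 + t) * (x ^+ 2 + 2 * (3 + 2 * T))))).
      by apply/funext => w; rewrite /penalized_gap /parabola; field.
    apply: is_derive_eq.
      by apply/is_derive_add_quadratic/(fp_space fp); exact: lt_trans xz.
    by field.
  - by rewrite in_itv/= lt_min xx' x'N.
  - move=> z; rewrite in_itv/= lt_min => /and3P[xz zN zS].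
    by apply: maxx' => //; [exact: ltW|exact: ltW|exact: lt_trans xz].
  - exact/is_derive_add_quadratic/(fp_slope fp).
have qxK : - q (x, t) <= - K + 2 * eps * (1 + t).
  suff : (-1) * q (x, t) + (2 * 0 * x + (K - 2 * eps * (1 + t))) <= 0 by lra.
  apply: (@second_derivative_le0_at_max R (fun z : R => penalized_gap u p K c d eps T z x' t)
    (fun z : R => (-1) * v (z, t) + (0 * z ^+ 2 + (K - 2 * eps * (1 + t)) * z + (p - K * x')))
    (Num.max a (Num.max (- N) (x' - S))) x' x).
  - move=> z; rewrite in_itv/= !gt_max => /andP[/and3P[az Nz Sz] zx'].
    have -> : (fun z : R => penalized_gap u p K c d eps T z x' t) = (fun z : R =>
      (-1) * u (z, t) + ((K / 2 - eps * (1 + t)) * z ^+ 2 + (p - K * x') * z +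
       (u (x', t) - p * x' + K * x' ^+ 2 / 2 + c * t - d -
         eps * (1 + t) * (x' ^+ 2 + 2 * (3 + 2 * T))))).
      by apply/funext => w; rewrite /penalized_gap /parabola; field.
    apply: is_derive_eq; first exact/is_derive_add_quadratic/(fp_space fp).
    by field.
  - by rewrite in_itv/= !gt_max ax xN xx' ltrBlDr x'S.
  - move=> z; rewrite in_itv/= !gt_max => /andP[/and3P[az Nz Sz] zx'].
    apply: maxx => //; [exact: ltW|by rewrite -lerBlDr ltW|exact: lt_trans x'N].
  - exact/is_derive_add_quadratic/(fp_slope fp).
(* Adding both bounds to [c <= 2 * atan K] leaves [4 * eps * (1 + t)], less than the
   [2 * eps * (3 + 2 * T)] subtracted in [dt]. *)
have a1 := atan_le_slope qx'K et.
have := atan_le_slope qxK et; rewrite atanN => a2.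
have : eps * t <= eps * T by rewrite ler_pM2l.
by lra.
Qed.

Lemma flux_potentialW (R : realType) (a b : R) (u v q : R * R -> R) (k : R -> R) :
  a <= b -> flux_potential a u v q k -> flux_potential b u v q k.
Proof.
move=> ab [h1 h2 h3 h4]; split => [y /(le_lt_trans ab)|y s /(le_lt_trans ab)||y s].
- exact: h1.
- exact: h2.
- exact: h3.
- by move=> /(le_lt_trans ab); exact: h4.
Qed.

Lemma continuous_sqr_comp (R : realType) (T : topologicalType) (f : T -> R) (z : T) :
  {for z, continuous f} -> {for z, continuous (fun w => f w ^+ 2)}.
Proof. by move=> cf; apply: (@continuousM _ _ f f). Qed.

Lemma continuous_penalized_gap (R : realType) (u v q : R * R -> R) (k : R -> R)
    (a p K c d eps T x s t : R) :
  flux_potential a u v q k -> a < x -> 0 <= s ->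
  {for (x, s, t), continuous (fun z : R * R * R =>
    penalized_gap u p K c d eps T z.1.1 (z.1.1 + z.1.2) z.2)}.
Proof.
move=> fp ax s0; rewrite /penalized_gap /parabola.
have c1 : {for (x, s, t), continuous (fun z : R * R * R => z.1.1)}.
  by apply: (@continuous_comp _ _ _ fst fst); exact: cvg_fst.
have c2 : {for (x, s, t), continuous (fun z : R * R * R => z.1.2)}.
  by apply: (@continuous_comp _ _ _ fst snd); [exact: cvg_fst|exact: cvg_snd].
have c3 : {for (x, s, t), continuous (fun z : R * R * R => z.2)} by exact: cvg_snd.
have c12 : {for (x, s, t), continuous (fun z : R * R * R => z.1.1 + z.1.2)}.
  exact: continuousD.
have cu (f : R * R * R -> R) : {for (x, s, t), continuous f} -> a < f (x, s, t) ->
    {for (x, s, t), continuous (fun z => u (f z, z.2))}.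
  move=> cf af; apply: (@continuous_comp _ _ _ (fun z : R * R * R => (f z, z.2)) u).
    exact: (cvg_pair cf c3).
  exact: (fp_continuous fp).
have cc (r : R) : {for (x, s, t), continuous (fun=> r : R)} by exact: cvg_cst.
apply: continuousB; first apply: continuousB; first apply: continuousB.
- by apply: cu => //=; rewrite ltr_wpDr.
- exact: cu.
- apply: continuousD => //; apply: continuousB; last exact: continuousM.
  apply: continuousB; first by apply: continuousM => //; exact: continuousB.
  by do 2 apply: continuousM => //; apply: continuous_sqr_comp; exact: continuousB.
- apply: continuousM; first by apply: continuousM => //; exact: continuousD.
  by apply: continuousD => //; apply: continuousD; exact: continuous_sqr_comp.
Qed.

(** The expression is twice the positive part of [f ^+ 2 - N ^+ 2], hence zero where [f] lies in
    [[- N, N]]. *)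
Lemma continuous_lateral_penalty (R : realType) (T : topologicalType) (f : T -> R)
    (N : R) (z : T) :
  {for z, continuous f} ->
  {for z, continuous (fun w => `|f w ^+ 2 - N ^+ 2| + (f w ^+ 2 - N ^+ 2))}.
Proof.
move=> cf; have cg : {for z, continuous (fun w => f w ^+ 2 - N ^+ 2)}.
  by apply: continuousB; [exact: continuous_sqr_comp|exact: cvg_cst].
by apply: continuousD => //; apply: continuous_comp cg _; exact: norm_continuous.
Qed.

(** A lateral penalty vanishing on [[- N, N]] is subtracted from the gap. A positive maximum over
    the box then avoids the lateral boundary by the size of that penalty, and the faces [t = 0],
    [s = 0] and [s = S] by the three comparison hypotheses; [penalized_gap_max] excludes the
    remaining positions. *)
Lemma two_point_comparison_local (R : realType) (u v q : R * R -> R) (k : R -> R)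
    (a p K c d eps T N L S : R) :
  flux_potential a u v q k ->
  0 < eps -> 2 * pi <= eps * N ^+ 2 -> 0 <= N -> N < L -> a < - L ->
  c <= 2 * atan K -> 0 <= T -> 0 <= S ->
  (forall x x', - L <= x -> x <= x' -> x' <= x + S ->
    u (x', 0) - u (x, 0) <= parabola p K c d (x' - x) 0) ->
  (forall t, 0 <= t -> t <= T -> c * t <= d) ->
  (forall x t, - L <= x -> x + S < L -> 0 <= t -> t <= T ->
    u (x + S, t) - u (x, t) <= parabola p K c d S t) ->
  forall x x' t, - N <= x -> x <= x' -> x' <= x + S -> x' <= N -> 0 <= t -> t <= T ->
    penalized_gap u p K c d eps T x x' t <= 0.
Proof.
move=> fp e0 epsN N0 NL aL cK T0 S0 init diag lateral x x' t Nx xx' xS x'N t0 tT.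
have L0 : 0 <= L by lra.
pose G (z : R * R * R) := penalized_gap u p K c d eps T z.1.1 (z.1.1 + z.1.2) z.2.
have cG y s r : - L <= y <= L -> 0 <= s <= S -> 0 <= r <= T ->
    {for (y, s, r), continuous G}.
  move=> /andP[Ly _] /andP[s0 _] _.
  by apply: continuous_penalized_gap fp _ _ => //; exact: lt_le_trans Ly.
have [xm [sm [tm [_ _ _ Gmax]]]] := exists_max_box L0 S0 T0 cG.
set B0 := G (xm, sm, tm) in Gmax.
pose w (z : R) := `|z ^+ 2 - N ^+ 2| + (z ^+ 2 - N ^+ 2).
have w0 z : 0 <= w z by rewrite /w -lerBlDr sub0r ler_normr lexx orbT.
have wN z : - N <= z -> z <= N -> w z = 0.
  by move=> ? ?; rewrite /w ler0_norm ?addNr//; nra.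
have LN0 : 0 < L ^+ 2 - N ^+ 2 by nra.
(* Beyond [L] the function [w] is at least [L ^+ 2 - N ^+ 2], so this slope makes [B * w] dominate
   the maximum [B0] of [G]. *)
pose B := `|B0| / (L ^+ 2 - N ^+ 2).
have B_ge0 : 0 <= B by rewrite divr_ge0// ltW.
have wL z : L <= `|z| -> B0 <= B * w z.
  move=> Lz; have z2 : L ^+ 2 <= z ^+ 2 by rewrite -[leRHS]real_normK ?num_real//; nra.
  have : L ^+ 2 - N ^+ 2 <= w z.
    by rewrite /w ger0_norm; nra.
  move=> /(ler_wpM2l B_ge0); apply: le_trans.
  by rewrite /B divfK ?gt_eqF// ler_norm.
pose F (z : R * R * R) := G z - B * (w z.1.1 + w (z.1.1 + z.1.2)).
have cF y s r : - L <= y <= L -> 0 <= s <= S -> 0 <= r <= T ->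
    {for (y, s, r), continuous F}.
  move=> hx hs ht; apply: continuousB; first exact: cG.
  apply: continuousM; first exact: cvg_cst.
  have c1 : {for (y, s, r), continuous (fun z : R * R * R => z.1.1)}.
    by apply: (@continuous_comp _ _ _ fst fst); exact: cvg_fst.
  have c2 : {for (y, s, r), continuous (fun z : R * R * R => z.1.2)}.
    by apply: (@continuous_comp _ _ _ fst snd); [exact: cvg_fst|exact: cvg_snd].
  apply: continuousD; apply: continuous_lateral_penalty => //.
  exact: continuousD.
have [xM [sM [tM [/andP[LxM xML] /andP[sM0 sMS] /andP[tM0 tMT] Fmax]]]] :=
  exists_max_box L0 S0 T0 cF.
(* On [[- N, N]] the penalty is zero and [F] agrees with [G], so a nonpositive maximum is already
   the claim. *)
have [FM0|FM0] := leP (F (xM, sM, tM)) 0.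
  have : F (x, x' - x, t) <= 0.
    apply: (le_trans (Fmax _ _ _ _ _ _) FM0); apply/andP; split => //.
    - by apply: le_trans Nx; rewrite lerN2 ltW.
    - exact: le_trans xx' (le_trans x'N (ltW NL)).
    - by rewrite subr_ge0.
    - by rewrite lerBlDl.
  have Nx' : - N <= x' := le_trans Nx xx'.
  by rewrite /F /G /= (addrC x) subrK !wN ?addr0 ?mulr0 ?subr0// (le_trans xx').
exfalso.
pose yM := xM + sM.
have FG : F (xM, sM, tM) = G (xM, sM, tM) - B * (w xM + w yM) by [].
have G_M : G (xM, sM, tM) = penalized_gap u p K c d eps T xM yM tM by [].
have Bx : 0 <= B * w xM by rewrite mulr_ge0.
have By : 0 <= B * w yM by rewrite mulr_ge0.
have GB0 : G (xM, sM, tM) <= B0 by apply: Gmax; apply/andP.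
have pos : 0 < penalized_gap u p K c d eps T xM yM tM by rewrite -G_M; lra.
have penalty_ge0 : 0 <= eps * (1 + tM) * (xM ^+ 2 + yM ^+ 2 + 2 * (3 + 2 * T)).
  rewrite mulr_ge0//; first by rewrite mulr_ge0 ?addr_ge0// ltW.
  by rewrite !addr_ge0 ?sqr_ge0// mulr_ge0// addr_ge0// mulr_ge0.
have gap_gt : parabola p K c d sM tM < u (yM, tM) - u (xM, tM).
  move: pos; rewrite /penalized_gap (_ : yM - xM = sM); last by rewrite /yM addrC addKr.
  by lra.
have tM_gt0 : 0 < tM.
  rewrite lt_neqAle tM0 andbT; apply/eqP => tM00; move: gap_gt; rewrite -tM00.
  have := init xM yM LxM; rewrite {2 4}/yM lerD2l lerDl => /(_ sM0 sMS).
  by rewrite (_ : yM - xM = sM); [lra|rewrite /yM addrC addKr].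
have sM_gt0 : 0 < sM.
  rewrite lt_neqAle sM0 andbT; apply/eqP => sM00; move: gap_gt.
  rewrite /yM /parabola -sM00 addr0; have := diag tM tM0 tMT; lra.
have absxM : `|xM| < L.
  rewrite ltNge; apply/negP => /wL; rewrite FG in FM0; lra.
have absyM : `|yM| < L.
  rewrite ltNge; apply/negP => /wL; rewrite FG in FM0; lra.
move: (absxM) (absyM); rewrite !ltr_norml => /andP[LxM' xML'] /andP[LyM yML].
have sM_ltS : sM < S.
  rewrite lt_neqAle sMS andbT; apply/eqP => sMS'; move: gap_gt.
  have := lateral xM tM LxM; rewrite -sMS' -/yM => /(_ yML tM0 tMT); lra.
(* Maximality of [F] passes to the unpenalized gap under any move that does not increase the lateral
   penalty: a move in time, or one of a point within [(- N, N)]. *)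
have inner z z' r : - L <= z -> z <= L -> 0 <= z' - z <= S -> 0 <= r <= T ->
   w z + w z' <= w xM + w yM ->
   penalized_gap u p K c d eps T z z' r <= penalized_gap u p K c d eps T xM yM tM.
  move=> Lz zL zz' r0 ww.
  have : F (z, z' - z, r) <= F (xM, sM, tM) by apply: Fmax => //; apply/andP.
  rewrite /F /G /= (addrC z) subrK -/yM.
  move=> gap_le; rewrite -[leLHS](subrK (B * (w z + w z'))).
  by apply: le_trans (lerD gap_le (ler_wpM2l B_ge0 ww)) _; rewrite subrK.
have xy : xM < yM by rewrite /yM ltrDl.
apply: (penalized_gap_max (a := - L) (N := N) (S := S) (x := xM) (x' := yM) _ e0 epsN N0 cK tMT LxM' xy _ tM_gt0) => //.
- exact: flux_potentialW (ltW aL) fp.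
- by rewrite /yM ltrD2l.
- move=> h h0 hM; apply: inner => //.
    by rewrite subr_ge0 (ltW xy) lerBlDl lerD2l.
  by rewrite subr_ge0 (ltW hM)/= (le_trans _ tMT)// gerBl ltW.
- move=> NxM yMN z xz zS Nz zN; have NyM : - N < yM := lt_trans NxM xy.
  apply: inner => //; first by rewrite subr_ge0 xz lerBlDl.
    by apply/andP.
  by rewrite (wN z (ltW Nz) (ltW zN)) (wN yM (ltW NyM) (ltW yMN)) !addr0.
- move=> NxM yMN z Lz zy yz Nz zN; have xMN : xM < N := lt_trans xy yMN.
  apply: inner => //.
  + exact: ltW.
  + exact/ltW/(lt_trans zN).
  + by rewrite subr_ge0 zy lerBlDl.
  + by apply/andP.
  + by rewrite (wN z (ltW Nz) (ltW zN)) (wN xM (ltW NxM) (ltW xMN)).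
Qed.

(** * Integrals over space slices: continuity and derivatives *)

(** A function of the pair, so that joint continuity can be stated. For [p.1 < a] the interval is
    empty and the value is 0; the base point is therefore kept to the left of the points
    considered. *)
Definition slice_integral (R : realType) (f : R * R -> R) (a : R) (p : R * R) : R :=
  (\int[@lebesgue_measure R]_(s in `[a, p.1]) f (s, p.2))%R.

Lemma continuous_slice (R : realType) (T : topologicalType) (f : R * R -> T) (x t : R) :
  {for (x, t), continuous f} -> {for x, continuous (fun z : R => f (z, t))}.
Proof.
move=> cf; apply: (@continuous_comp _ _ _ (fun z : R => (z, t)) f) => //.
have ci : {for x, continuous (@id R)} by exact: cvg_id.
have ct : {for x, continuous (fun=> t : R)} by exact: cvg_cst.
exact: (cvg_pair ci ct).
Qed.

Lemma continuous_time_slice (R : realType) (T : topologicalType) (f : R * R -> T) (x t : R) :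
  {for (x, t), continuous f} -> {for t, continuous (fun s : R => f (x, s))}.
Proof.
move=> cf; apply: (@continuous_comp _ _ _ (fun s : R => (x, s)) f) => //.
have ci : {for t, continuous (@id R)} by exact: cvg_id.
have ct : {for t, continuous (fun=> x : R)} by exact: cvg_cst.
exact: (cvg_pair ct ci).
Qed.

Lemma integrable_slice (R : realType) (f : R * R -> R) (a x t : R) :
  (forall s : R, {for (s, t), continuous f}) ->
  (@lebesgue_measure R).-integrable `[a, x] (EFin \o (fun s => f (s, t))).
Proof.
move=> cf; apply: continuous_compact_integrable; first exact: segment_compact.
by apply: continuous_subspaceT => s; exact: continuous_slice.
Qed.

Lemma is_derive_slice_integral (R : realType) (f : R * R -> R) (a x t : R) :
  (forall s : R, {for (s, t), continuous f}) -> a < x ->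
  is_derive x 1 (fun z : R => slice_integral f a (z, t)) (f (x, t)).
Proof.
move=> cf ax; have xx1 : x < x + 1 by rewrite ltrDl.
have [dF FE] := continuous_FTC1_closed xx1 (integrable_slice _ _ cf) ax (continuous_slice (cf x)).
by apply: DeriveDef; [exact: dF|rewrite -derive1E; exact: FE].
Qed.

(** Independent of any base point; the interval is half-open so as to be the difference of two
    closed intervals with the same left end. *)
Definition mass (R : realType) (f : R * R -> R) (x x' t : R) : R :=
  (\int[@lebesgue_measure R]_(s in `]x, x']) f (s, t))%R.

Lemma slice_integralB (R : realType) (f : R * R -> R) (a x x' t : R) :
  (forall s : R, {for (s, t), continuous f}) -> a < x -> x <= x' ->
  slice_integral f a (x', t) - slice_integral f a (x, t) = mass f x x' t.
Proof.
move=> cf ax xx'; rewrite /slice_integral /mass /= Rintegral_itvB//.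
- exact: integrable_slice.
- by rewrite bnd_simp ltW.
Qed.

Lemma continuous_box_bound (R : realType) (f : R * R -> R) (a b c d : R) :
  (forall s t : R, a <= s <= b -> c <= t <= d -> {for (s, t), continuous f}) ->
  exists2 M : R, 0 <= M &
    forall s t : R, a <= s <= b -> c <= t <= d -> `|f (s, t)| <= M.
Proof.
move=> cf; pose D : set (R * R) := `[a, b] `*` `[c, d].
have cD : compact D by apply: compact_setX; exact: segment_compact.
have [[p0 Dp0]|] := pselect (exists p, D p); last first.
  move=> D0; exists 0 => // s t sab tcd; exfalso; apply: D0; exists (s, t).
  by rewrite /D /= !in_itv.
have [||[s0 t0] _ M] := @compact_EVT_max _ R (fun p => `|f p|) D _ cD.
- by exists p0.
- apply: continuous_in_subspaceT => -[s t]; rewrite inE /D /= !in_itv/= => -[? ?].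
  by apply: (@continuous_comp _ _ _ f Num.norm); [exact: cf|exact: norm_continuous].
exists `|f (s0, t0)| => // s t sab tcd.
by apply: (M (s, t)); rewrite inE /D /= !in_itv.
Qed.

(** Continuity in time at the fixed end [x0] comes from dominated convergence; in space the integral
    is Lipschitz, uniformly for nearby times, because its derivative [f] is bounded on a box. The
    two combine by the triangle inequality. *)
Lemma continuous_slice_integral (R : realType) (f : R * R -> R) (a : R) (p : R * R) :
  continuous f -> a < p.1 -> {for p, continuous (slice_integral f a)}.
Proof.
case: p => x0 t0 /= cf ax0.
have ct : {for t0, continuous (fun t : R => slice_integral f a (x0, t))}.
  have [M M0 fM] : exists2 M : R, 0 <= M &
      forall s t : R, a <= s <= x0 -> t0 - 1 <= t <= t0 + 1 -> `|f (s, t)| <= M.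
    by apply: continuous_box_bound => *; exact: cf.
  have := @continuity_under_integral R _ _ (@lebesgue_measure R)
    (fun t s => f (s, t)) `[a, x0] (measurable_itv _) (t0 - 1) (t0 + 1) _ _ (cst M).
  apply.
  - by move=> t _; apply: integrable_slice => s; exact: cf.
  - by apply: aeW => s _ t _; apply: continuous_time_slice; exact: cf.
  - apply: continuous_compact_integrable; first exact: segment_compact.
    by apply: continuous_subspaceT => s; exact: cvg_cst.
  - move=> t /=; rewrite in_itv/= => /andP[t1 t2]; apply: aeW => s /=; rewrite in_itv/=.
    by move=> sax; apply: fM => //; rewrite !ltW.
  - by rewrite inE/= in_itv/=; apply/andP; split; lra.
have [M M0 fM] : exists2 M : R, 0 <= M & forall s t : R, Num.min a x0 <= s <= x0 + 1 ->
    t0 - 1 <= t <= t0 + 1 -> `|f (s, t)| <= M.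
  by apply: continuous_box_bound => *; exact: cf.
have lip z w t : a < z -> z <= w -> w <= x0 + 1 -> t0 - 1 <= t <= t0 + 1 ->
    `|slice_integral f a (w, t) - slice_integral f a (z, t)| <= M * (w - z).
  move=> az zw wx tt; have cft s : {for (s, t), continuous f} by exact: cf.
  have [| |c] := @MVT_segment R (fun y : R => slice_integral f a (y, t))
    (fun y : R => f (y, t)) _ _ zw.
  - by move=> y; rewrite in_itv/= => /andP[zy _]; apply: is_derive_slice_integral => //; exact: lt_trans zy.
  - apply: derivable_within_continuous => y; rewrite in_itv/= => /andP[zy _].
    by have [] := @is_derive_slice_integral _ f a y t cft (lt_le_trans az zy).
  rewrite in_itv/= => /andP[zc cw] ->; rewrite normrM (@ger0_norm _ (w - z)) ?subr_ge0//.
  apply: ler_wpM2r; rewrite ?subr_ge0//; apply: fM => //.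
  by rewrite (le_trans cw)// andbT ge_min (ltW (lt_le_trans az zc)).
apply/cvgrPdist_lt => e e0.
have e2 : 0 < e / 2 by rewrite divr_gt0.
have /cvgrPdist_lt/(_ _ e2) ct2 := ct.
(* The radius keeps [q.1] inside the box and to the right of [a], with [M * r < e / 2]; [M + 1]
   avoids a division by zero. *)
pose r := Num.min (Num.min 1 (x0 - a)) (e / 2 / (M + 1)).
have M1 : 0 < M + 1 by rewrite ltr_wpDl.
have r0 : 0 < r by rewrite !lt_min ltr01 subr_gt0 ax0 divr_gt0.
have := lexx r; rewrite {2}/r !le_min => /andP[/andP[r1 rax] rM].
have rM2 : M * r < e / 2.
  apply: (@lt_le_trans _ _ ((M + 1) * r)); first by rewrite ltr_pM2r// ltrDl.
  by rewrite mulrC -ler_pdivlMr.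
have near_x : \forall z \near x0, `|x0 - z| < r by apply/nbhs_ballP; exists r.
have near_t : \forall s \near t0, `|t0 - s| < 1 by apply/nbhs_ballP; exists 1 => /=.
have nx : \forall q \near ((x0, t0) : R * R), `|x0 - q.1| < r by exact: cvg_fst near_x.
have nt : \forall q \near ((x0, t0) : R * R), `|t0 - q.2| < 1 by exact: cvg_snd near_t.
have ne : \forall q \near ((x0, t0) : R * R),
    `|slice_integral f a (x0, t0) - slice_integral f a (x0, q.2)| < e / 2.
  exact: cvg_snd ct2.
near=> q.
have xq : `|x0 - q.1| < r by near: q.
have tq : `|t0 - q.2| < 1 by near: q.
have eq2 : `|slice_integral f a (x0, t0) - slice_integral f a (x0, q.2)| < e / 2.
  by near: q.
have small : `|slice_integral f a (x0, q.2) - slice_integral f a q| < e / 2.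
  apply: le_lt_trans rM2; rewrite [q in X in _ - X]surjective_pairing.
  have tt : t0 - 1 <= q.2 <= t0 + 1 by move: tq; rewrite ltr_norml; lra.
  have [xq0|xq0] := leP x0 q.1.
    rewrite distrC; apply: (le_trans (lip _ _ _ ax0 xq0 _ tt)).
      by move: xq; rewrite ltr_norml => /andP[]; lra.
    by apply: ler_wpM2l => //; move: xq; rewrite ltr_norml => /andP[]; lra.
  have aq : a < q.1 by move: xq; rewrite ltr_norml => /andP[]; lra.
  apply: (le_trans (lip _ _ _ aq (ltW xq0) _ tt)); first by rewrite lerDl.
  by apply: ler_wpM2l => //; move: xq; rewrite ltr_norml => /andP[]; lra.
rewrite -(subrKA (slice_integral f a (x0, q.2))).
by rewrite (le_lt_trans (ler_normD _ _))// (splitr e) ltrD.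
Unshelve. all: by end_near. Qed.

(** Differentiation under the integral gives the integral of [g], and [g] is also the space
    derivative of [th], so the fundamental theorem leaves the flux difference. *)
Lemma is_derive_time_slice_integral (R : realType) (f g th : R * R -> R) (a x t : R) :
  a < x -> 0 < t -> continuous f ->
  (forall s r : R, 0 < r -> is_derive r 1 (fun w : R => f (s, w)) (g (s, r))) ->
  (forall s r : R, 0 < r -> is_derive s 1 (fun z : R => th (z, r)) (g (s, r))) ->
  (forall p : R * R, 0 < p.2 -> {for p, continuous g}) ->
  is_derive t 1 (fun r : R => slice_integral f a (x, r)) (th (x, t) - th (a, t)).
Proof.
move=> ax t0 cf fg thg cg.
(* The window from [t / 2] to [2 * t] stays away from time 0, where [g] need not be bounded. *)
have [M M0 gM] : exists2 M : R, 0 <= M &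
    forall s r : R, a <= s <= x -> t / 2 <= r <= 2 * t -> `|g (s, r)| <= M.
  apply: continuous_box_bound => s r _ /andP[tr _]; apply: cg => /=.
  by apply: lt_le_trans tr; rewrite divr_gt0.
have It : `]t / 2, 2 * t[%classic t by rewrite /= in_itv/=; apply/andP; split; lra.
have Igt0 (r : R) : `]t / 2, 2 * t[%classic r -> 0 < r.
  by rewrite /= in_itv/= => /andP[tr _]; apply: lt_trans tr; rewrite divr_gt0.
have intf (r : R) : `]t / 2, 2 * t[%classic r ->
    (@lebesgue_measure R).-integrable `[a, x] (EFin \o (fun s => f (s, r))).
  by move=> _; apply: integrable_slice => s; exact: cf.
have derf (r s : R) : `]t / 2, 2 * t[%classic r -> `[a, x]%classic s ->
    derivable (fun w : R => f (s, w)) r 1.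
  by move=> /Igt0 r0 _; have [] := fg s r r0.
have d1E (r s : R) : 0 < r -> partial1of2 (fun w s => f (s, w)) r s = g (s, r).
  by move=> r0; rewrite partial1of2E; have [_ <-] := fg s r r0.
have intM : (@lebesgue_measure R).-integrable `[a, x] (EFin \o (fun=> M : R)).
  apply: continuous_compact_integrable; first exact: segment_compact.
  by apply: continuous_subspaceT => s; exact: cvg_cst.
have ubM (r s : R) : `]t / 2, 2 * t[%classic r -> `[a, x]%classic s ->
    `|partial1of2 (fun w s => f (s, w)) r s| <= M.
  move=> Ir; have r0 := Igt0 _ Ir; rewrite d1E// /= in_itv/= => sax.
  by apply: gM => //; move: Ir; rewrite /= in_itv/= => /andP[? ?]; rewrite !ltW.
have mI : measurable (`[a, x]%classic : set (measurableTypeR R)) by exact: measurable_itv.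
apply: DeriveDef.
  exact: (derivable_under_integral mI It intf derf (fun=> M0) intM ubM).
rewrite -derive1E (differentiation_under_integral mI It intf derf (fun=> M0) intM ubM).
under eq_Rintegral do rewrite d1E//.
have cth (z : R) : {for z, continuous (fun s : R => th (s, t))}.
  apply/differentiable_continuous/derivable1_diffP.
  by have [] := thg z t t0.
rewrite /Rintegral (@continuous_FTC2 _ _ (fun s : R => th (s, t)))//.
- by apply: continuous_subspaceT => s; apply: continuous_slice; exact: cg.
- split.
  + by move=> z _; have [] := thg z t t0.
  + by apply: cvg_at_right_filter; exact: cth.
  + by apply: cvg_at_left_filter; exact: cth.
- by move=> z _; rewrite derive1E; have [_ ->] := thg z t t0.
Qed.

(** * The flux potential of an Ecker-Huisken solution *)

Lemma is_derive_partial_x (R : realType) (f : R * R -> R) (x t : R) :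
  derivable f (x, t) ((1, 0) : R * R) ->
  is_derive x 1 (fun z : R => f (z, t)) (partial_x f (x, t)).
Proof.
have E : (fun h : R => h^-1 *: (((fun z : R => f (z, t)) \o shift x) h%:A - f (x, t))) =
    (fun h : R => h^-1 *: ((f \o shift (x, t)) (h *: ((1, 0) : R * R)) - f (x, t))).
  apply/funext => h /=; congr (_ *: (f _ - _)).
  by congr pair; rewrite /= /GRing.scale /= ?mulr0 ?add0r.
by move=> df; apply: DeriveDef; rewrite /partial_x /derivable /derive E.
Qed.

Lemma is_derive_partial_t (R : realType) (f : R * R -> R) (x t : R) :
  derivable f (x, t) ((0, 1) : R * R) ->
  is_derive t 1 (fun s : R => f (x, s)) (partial_t f (x, t)).
Proof.
have E : (fun h : R => h^-1 *: (((fun s : R => f (x, s)) \o shift t) h%:A - f (x, t))) =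
    (fun h : R => h^-1 *: ((f \o shift (x, t)) (h *: ((0, 1) : R * R)) - f (x, t))).
  apply/funext => h /=; congr (_ *: (f _ - _)).
  by congr pair; rewrite /= /GRing.scale /= ?mulr0 ?add0r.
by move=> df; apply: DeriveDef; rewrite /partial_t /derivable /derive E.
Qed.

(* Values at negative times are unconstrained: freezing time at 0 there gives a
   function continuous on the whole plane. *)
Definition frozen_past (R : realType) (y : R * R -> R) (p : R * R) : R :=
  y (p.1, Num.max 0 p.2).

Lemma frozen_past_ge0 (R : realType) (y : R * R -> R) (x t : R) : 0 <= t -> frozen_past y (x, t) = y (x, t).
Proof. by move=> t0; rewrite /frozen_past /= max_r. Qed.

Lemma continuous_frozen_past (R : realType) (y0 : R -> R) (y : R * R -> R) :
  Ecker_Huisken_solution y0 y -> continuous (frozen_past y).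
Proof.
move=> sol p; rewrite /frozen_past.
have cp : {for p, continuous (fun q : R * R => (q.1, Num.max 0 q.2))}.
  have c1 : {for p, continuous (@fst R R)} by exact: cvg_fst.
  have c2 : {for p, continuous (@snd R R)} by exact: cvg_snd.
  have c0 : {for p, continuous (fun=> 0 : R)} by exact: cvg_cst.
  exact: cvg_pair c1 (continuous_max c0 c2).
have /subspace_continuousP cy := EH_continuous sol.
have max0_ge0 (r : R) : 0 <= Num.max 0 r by rewrite le_max lexx.
have q0 : [set q : R * R | 0 <= q.2] (p.1, Num.max 0 p.2) by exact: max0_ge0.
apply: (@cvg_comp _ _ _ (fun q : R * R => (q.1, Num.max 0 q.2)) y _ _ _ _ (cy _ q0)).
move=> B wB; have hB := cp _ wB.
move: hB; rewrite /nbhs /=; apply: filterS => q hB; apply: hB.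
exact: (max0_ge0 q.2).
Qed.

Lemma solution_derivatives (R : realType) (y0 : R -> R) (y : R * R -> R) (x t : R) :
  Ecker_Huisken_solution y0 y -> 0 < t ->
  [/\ is_derive x 1 (fun z : R => y (z, t)) (partial_x y (x, t)),
      is_derive t 1 (fun s : R => y (x, s)) (partial_t y (x, t)),
      is_derive x 1 (fun z : R => partial_x y (z, t)) (partial_x (partial_x y) (x, t)) &
      {for (x, t), continuous (partial_t y)}].
Proof.
move=> sol t0; have [_ [dx dt [_ [dxx _ _ _]] [ct _]]] := EH_smooth sol 2.
split.
- by apply: is_derive_partial_x; exact: dx.
- by apply: is_derive_partial_t; exact: dt.
- by apply: is_derive_partial_x; exact: dxx.
- exact: ct.
Qed.

(** This is the divergence form [y_t = (atan y_x)_x], integrated in space from [a]. *)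
Lemma flux_potential_solution (R : realType) (y0 : R -> R) (y : R * R -> R) (a : R) :
  Ecker_Huisken_solution y0 y ->
  flux_potential a (slice_integral (frozen_past y) a) (frozen_past y)
    (partial_x y) (fun t => atan (partial_x y (a, t))).
Proof.
move=> sol; have yE (x t : R) : 0 < t -> \near t, y (x, t) = frozen_past y (x, t).
  move=> t0; near=> s; rewrite frozen_past_ge0// ltW//.
  by near: s; exact: lt_nbhsr.
split.
- by move=> p ap; apply: continuous_slice_integral => //; exact: (continuous_frozen_past sol).
- by move=> x t ax; apply: is_derive_slice_integral => // s; exact: (continuous_frozen_past sol).
- move=> x t t0; have [dx _ _ _] := solution_derivatives x sol t0.
  suff -> : (fun z : R => frozen_past y (z, t)) = (fun z : R => y (z, t)) by [].
  by apply/funext => z; rewrite frozen_past_ge0// ltW.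
- move=> x t ax t0.
  apply: (@is_derive_time_slice_integral _ _ (partial_t y)
    (fun p => atan (partial_x y p))) => //.
  + exact: (continuous_frozen_past sol).
  + move=> s r r0; have [_ dt _ _] := solution_derivatives s sol r0.
    by apply: near_eq_is_derive dt; exact: yE.
  + move=> s r r0; have [_ _ dxx _] := solution_derivatives s sol r0.
    have datan := is_derive1_atan (partial_x y (s, r)).
    have := is_derive1_comp datan dxx.
    by rewrite (EH_equation sol)// mulrC.
  + by move=> [s r] /= r0; have [] := solution_derivatives s sol r0.
Unshelve. all: by end_near. Qed.

(** * Comparison of masses on the whole line *)

(** The local comparison is applied with a small [eps] and then a large [N]. An extended real [S]
    covers both uses: for [S = +oo] the lateral hypothesis is vacuous, as no gap is infinite. *)
Lemma mass_comparison (R : realType) (y0 : R -> R) (y : R * R -> R)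
    (p K c d T : R) (S : \bar R) :
  Ecker_Huisken_solution y0 y -> c <= 2 * atan K -> 0 <= T ->
  (forall x x' : R, x <= x' -> ((x' - x)%:E <= S)%E ->
    mass (frozen_past y) x x' 0 <= parabola p K c d (x' - x) 0) ->
  (forall t : R, 0 <= t -> t <= T -> c * t <= d) ->
  (forall x x' t : R, (x' - x)%:E = S -> 0 <= t -> t <= T ->
    mass (frozen_past y) x x' t <= parabola p K c d (x' - x) t) ->
  forall x x' t : R, x <= x' -> ((x' - x)%:E <= S)%E -> 0 <= t -> t <= T ->
    mass (frozen_past y) x x' t <= parabola p K c d (x' - x) t.
Proof.
move=> sol cK T0 init diag lateral x x' t xx' xS t0 tT.
apply/ler_addgt0Pr => e e0.
pose C := (1 + t) * (x ^+ 2 + x' ^+ 2 + 2 * (3 + 2 * T)).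
have C0 : 0 <= C.
  by rewrite /C mulr_ge0// !addr_ge0 ?sqr_ge0// !mulr_ge0// addr_ge0// mulr_ge0.
pose eps := e / (C + 1).
have C1 : 0 < C + 1 by rewrite ltr_wpDl.
have eps0 : 0 < eps by rewrite divr_gt0.
have epsC : eps * C <= e.
  by rewrite /eps mulrAC ler_pdivrMr// ler_pM2l// lerDl.
have pi_eps : 0 <= 2 * pi / eps by rewrite divr_ge0 ?(ltW eps0)// mulr_ge0 ?pi_ge0.
(* The terms ensure [N >= 1], [eps * N >= 2 * pi] (hence [eps * N ^+ 2 >= 2 * pi]) and that both
   points lie in [[- N, N]]. *)
pose N := 1 + 2 * pi / eps + `|x| + `|x'|.
have [nx nx'] : 0 <= `|x| /\ 0 <= `|x'| by rewrite !normr_ge0.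
have [xN x'N] : `|x| <= N /\ `|x'| <= N by rewrite /N; split; lra.
have N1 : 1 <= N by rewrite /N; lra.
have epsN : 2 * pi <= eps * N ^+ 2.
  apply: (@le_trans _ _ (eps * N)); last first.
    by rewrite ler_pM2l// expr2 ler_peMl// (le_trans ler01).
  have : 2 * pi / eps <= N by rewrite /N -!addrA addrCA lerDl !addr_ge0.
  by rewrite ler_pdivrMr// (mulrC N).
have [Nx x'N'] : - N <= x /\ x' <= N.
  by move: xN x'N; rewrite !ler_norml => /andP[? _] /andP[_ ?].
pose L := N + 1.
have cf s r : {for (s, r), continuous (frozen_past y)} by exact: (continuous_frozen_past sol).
have massE z w r : - L <= z -> z <= w ->
    slice_integral (frozen_past y) (- L - 1) (w, r) -
    slice_integral (frozen_past y) (- L - 1) (z, r) = mass (frozen_past y) z w r.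
  by move=> Lz zw; apply: slice_integralB => //; lra.
have [r [r0 xr rS rlat]] : exists r : R, [/\ 0 <= r, x' - x <= r,
    forall s : R, s <= r -> (s%:E <= S)%E &
    forall z : R, - L <= z -> z + r < L -> r%:E = S].
  case: S xS {init lateral} => [r| |//] xS.
    by exists r; split => //; rewrite -lee_fin// (le_trans _ xS)// lee_fin subr_ge0.
  (* This width exceeds [2 * L = 2 * N + 2], so no pair at distance [r] fits in the box and the
     lateral face is empty. *)
  exists (2 * N + 3); split => [| |s _|z Lz zL].
  - lra.
  - by move: Nx x'N'; lra.
  - exact: leey.
  - by exfalso; move: Lz zL; rewrite /L; lra.
have := @two_point_comparison_local R _ _ _ _ (- L - 1) p K c d eps T N L r
  (flux_potential_solution _ sol) eps0 epsN (le_trans ler01 N1) _ _ cK T0 r0.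
move=> /(_ _ _ _ diag _ x x' t Nx xx' _ x'N' t0 tT) gap.
have gapE : penalized_gap (slice_integral (frozen_past y) (- L - 1)) p K c d eps T x x' t =
    mass (frozen_past y) x x' t - parabola p K c d (x' - x) t - eps * C.
  rewrite /penalized_gap massE//; first by rewrite /C mulrA.
  by apply: le_trans Nx; rewrite lerN2 lerDl.
rewrite gapE in gap.
rewrite -lerBlDl; apply: (le_trans _ epsC); rewrite -subr_le0; apply: gap.
- by rewrite /L ltrDl.
- by rewrite gtrDl ltrN10.
- move=> z w Lz zw wr; rewrite massE//; apply: init => //.
  by apply: rS; rewrite lerBlDl.
- move=> z s Lz zrL s0 sT; rewrite massE// ?lerDl//.
  have zr : z + r - z = r by rewrite addrAC subrr add0r.
  by rewrite -{2}zr; apply: lateral => //; rewrite zr; exact: rlat zrL.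
- by rewrite -lerBlDl.
Qed.

(** * The initial mass and the final bound *)

Lemma initial_mass_le (R : realType) (y0 : R -> R) (y : R * R -> R) (A0 x x' : R) :
  Ecker_Huisken_solution y0 y -> (forall z, 0 <= y0 z) ->
  'N[@lebesgue_measure R]_1 [EFin \o y0]%E = A0%:E ->
  mass (frozen_past y) x x' 0 <= A0.
Proof.
move=> sol y0_ge0 y0A0.
(* As the time 0 slice of [frozen_past y], the initial datum is continuous, hence measurable. *)
have cy0 : continuous y0.
  move=> z; have -> : y0 = fun s => frozen_past y (s, 0).
    by apply/funext => s; rewrite frozen_past_ge0// (EH_initial sol).
  exact/continuous_slice/(continuous_frozen_past sol).
have le_A0 : (\int[@lebesgue_measure R]_(s in `]x, x']) (y0 s)%:E <= A0%:E)%E.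
  rewrite -y0A0 Lnorm1.
  under [leRHS]eq_integral do rewrite /= ger0_norm//.
  apply: ge0_subset_integral => //=.
  - apply/measurable_EFinP; exact: continuous_measurable_fun.
  - by move=> s _; rewrite lee_fin.
rewrite /mass; under eq_Rintegral do rewrite frozen_past_ge0// (EH_initial sol).
rewrite -[A0]/(fine A0%:E) /Rintegral; apply: fine_le => //.
rewrite ge0_fin_numE; first exact: le_lt_trans le_A0 (ltry _).
by apply: integral_ge0 => s _; rewrite lee_fin.
Qed.

Theorem corollary1p7 (R : realType) :
  exists C : R,
    forall (y0 : R -> R) (A0 : R) (y : R * R -> R),
      (forall x : R, 0 <= y0 x) ->
      locally_lipschitz y0 ->
      'N[@lebesgue_measure R]_1 [EFin \o y0]%E = A0%:E ->
      0 < A0 ->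
      Ecker_Huisken_solution y0 y ->
      forall t : R, 2 * A0 / pi <= t ->
      forall x : R, y (x, t) <= C * Num.sqrt t.
Proof.
exists 2 => y0 A0 y y0_ge0 _ y0A0 A0_gt0 sol t tA0 x.
have pi0 : 0 < pi :> R := pi_gt0 R.
have t0 : 0 < t by apply: lt_le_trans tA0; rewrite divr_gt0// mulr_gt0.
pose A := pi / 2 * t.
have A0A : A0 <= A by move: tA0; rewrite ler_pdivrMr// /A; lra.
have A_ge0 : 0 <= A by rewrite (le_trans _ A0A)// ltW.
set l := Num.sqrt t.
have l0 : 0 < l by rewrite sqrtr_gt0.
have lt2 : l ^+ 2 = t by rewrite sqr_sqrtr// ltW.
(* First barrier: the constant [A], for gaps of any length. *)
have massA z w s : z <= w -> 0 <= s -> s <= t -> mass (frozen_past y) z w s <= A.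
  move=> zw s0 st.
  have -> : A = parabola 0 0 0 A (w - z) s by rewrite /parabola; ring.
  apply: (mass_comparison (T := t) (S := +oo%E) sol) => //.
  - by rewrite atan0 mulr0.
  - exact: ltW.
  - move=> z' w' _ _; apply: (le_trans (initial_mass_le _ _ sol y0_ge0 y0A0)).
    by rewrite /parabola; lra.
  - by move=> r _ _; rewrite mul0r.
  - by rewrite leey.
have pi4 : pi <= 4 :> R by have := pihalf_lt2 R; lra.
(* Second barrier: at time [t] the terms [A] and [pi / 2 * t] cancel, leaving at most
   [2 * l * s]. *)
have massl z w : z <= w -> w - z <= 2 * l -> mass (frozen_past y) z w t <= 2 * l * (w - z).
  move=> zw wz.
  apply: (@le_trans _ _ (parabola (2 * l) 1 (pi / 2) A (w - z) t)); last first.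
    rewrite /parabola /A; have := sqr_ge0 (w - z); lra.
  apply: (mass_comparison (T := t) (S := (2 * l)%:E) sol) => //.
  - by rewrite atan1; lra.
  - exact: ltW.
  - move=> z' w' zw'; rewrite lee_fin => wz'.
    apply: (le_trans (initial_mass_le _ _ sol y0_ge0 y0A0)).
    by rewrite /parabola; nra.
  - by move=> r _ rt; rewrite /A ler_pM2l// divr_gt0.
  (* At gap [2 * l] the parabola equals [2 * l ^+ 2 + A - pi / 2 * s], at least [A] because
     [s <= l ^+ 2] and [pi <= 4]; the first barrier applies. *)
  - move=> z' w' s [wzl] s0 st; apply: (le_trans (massA _ _ _ _ s0 st)).
      by rewrite -subr_ge0 wzl mulr_ge0// ltW.
    rewrite /parabola wzl.
    have : pi / 2 * s <= 2 * l ^+ 2 by rewrite lt2; nra.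
    lra.
  - exact: ltW.
have cf s r : {for (s, r), continuous (frozen_past y)} by exact: (continuous_frozen_past sol).
have x1x : x - 1 < x by rewrite gtrBl.
rewrite -(frozen_past_ge0 y x (ltW t0)).
(* The value [y (x, t)] is the derivative of the primitive based at [x - 1]; its right difference
   quotients are masses divided by gaps, at most [2 * l] for gaps up to [2 * l]. *)
apply: (is_derive_le (is_derive_slice_integral (fun s => cf s t) x1x)) => e e0.
have m0 : 0 < Num.min e (2 * l) / 2 by rewrite divr_gt0// lt_min e0 mulr_gt0.
have := lexx (Num.min e (2 * l)); rewrite le_min => /andP[me ml].
exists (Num.min e (2 * l) / 2); split; rewrite ?gt_eqF// ?gtr0_norm//; first lra.
rewrite ler_pdivrMr// slice_integralB ?lerDl ?(ltW m0)//.
have := massl x (x + Num.min e (2 * l) / 2).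
have -> : x + Num.min e (2 * l) / 2 - x = Num.min e (2 * l) / 2.
  by rewrite addrAC subrr add0r.
by rewrite lerDl; apply; [exact: ltW|lra].
Qed.
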